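(* For every positive integer $n$, there are at least $C_n$ distinct families (sets) $\mathcal F$ of lattice paths from $(0,0)$ to $(n,n)$ such that $|\mathcal F|=2^n$ and $|F\cap G|$ is even for every two distinct $F,G\in\mathcal F$; all of these families are extremal, i.e. they have the maximum possible size among families of lattice paths from $(0,0)$ to $(n,n)$ in which every two distinct paths have an even number of common edges.
   Context: A lattice path is a finite sequence of vertices $F=(v_0,v_1,\dots,v_k)\in(\mathbb Z^2)^{k+1}$ such that $v_i-v_{i-1}\in\{(0,1),(1,0)\}$ for all $1\le i\le k$ (a North-East lattice path). It is a path from $v_0$ to $v_k$. Its edge set is $E(F)=\{\{v_i,v_{i+1}\}:0\le i<k\}$. For two lattice paths $F,G$ both starting at $(0,0)$, define $F\cap G:=E(F)\cap E(G)$, so that $|F\cap G|$ is the number of common edges. $C_n=\frac{1}{n+1}\binom{2n}{n}$ is the $n$th Catalan number. *)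

(* Defs.v *)
From mathcomp Require Import all_boot all_order all_algebra finmap.
Set Implicit Arguments.
Unset Strict Implicit.
Unset Printing Implicit Defensive.

Local Open Scope fset_scope.

Notation vertex := (int * int)%type.

Definition NE_step (u v : vertex) : bool :=
  let d := (v.1 - u.1, v.2 - u.2)%R in
  (d == (0, 1)%R) || (d == (1, 0)%R).

Definition lattice_path (F : seq vertex) : bool :=
  (F != [::]) && sorted NE_step F.

Definition lattice_path_from_to (u v : vertex) (F : seq vertex) : bool :=
  [&& lattice_path F, head u F == u & last v F == v].

Definition edge_set (F : seq vertex) : {fset {fset vertex}} :=
  [fset [fset e.1; e.2] | e in zip F (behead F)].

Definition common_edges (F G : seq vertex) : {fset {fset vertex}} :=
  edge_set F `&` edge_set G.

(* Finite sets suffice for families: there are finitely many lattice paths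
   between two given vertices. *)
Definition path_family (n : nat) (A : {fset seq vertex}) : Prop :=
  forall F, F \in A ->
    lattice_path_from_to (0%:Z, 0%:Z)%R (n%:Z, n%:Z)%R F.

Definition pairwise_even (A : {fset seq vertex}) : Prop :=
  forall F G, F \in A -> G \in A -> F != G -> ~~ odd #|` common_edges F G|.

Definition even_path_family (n : nat) (A : {fset seq vertex}) : Prop :=
  path_family n A /\ pairwise_even A.

Definition extremal (n : nat) (A : {fset seq vertex}) : Prop :=
  even_path_family n A /\
  forall B : {fset seq vertex}, even_path_family n B -> #|` B| <= #|` A|.

(* The division is exact. *)
Definition catalan (n : nat) : nat := 'C(2 * n, n) %/ n.+1.

(* Main.v *)
Require Import Defs.
From mathcomp Require Import all_boot all_order all_algebra finmap.
From mathcomp Require Import zify.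

(** A lattice path is coded by its starting abscissa and a word of booleans,
    [true] for an East step.  Two paths that start on the same antidiagonal
    [x + y = c] can only share an edge at equal positions, so the number of
    common edges is computed letter by letter ([overlap]).

    Upper bound.  It is convenient to prove more ([pairwise_odd_bound]): a set
    of paths of length [2k+1] starting on one antidiagonal, any two of which
    have an odd number of common edges, has at most [2^k] members.  Putting a
    common first edge in front of the members of an even family of paths of
    length [2n] gives such a set with [k = n].  The bound is proved by
    induction on [k]: the set is cut into two groups, and on each group
    deleting the first two edges is injective and keeps all the pairwise
    parities odd.  Let [v] be the vertex after the first edge, and call a path
    straight when its first two edges have the same direction.  Two paths
    through different [v] lose no common edge; two paths through the same [v]
    lose an even number of them exactly when both are straight or both are not
    ([odd_meet_drop2]).  Hence at a vertex [v] with paths of both kinds the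
    kind decides the group.  At the other vertices the choice is free and
    serves injectivity: two paths through different [v] can only have the same
    remainder if their second edges have different directions, and then both
    vertices carry paths of one kind only ([collision_not_mixed]), so grouping
    by the direction of the second edge separates them.

    Construction.  A Dyck word of length [2n] matches its [n] opening letters
    with its [n] closing letters without crossings.  Take all the words of
    length [2n] that have different letters at any two matched positions.
    There are [2^n] of them.  Between two matched positions every such word
    has as many North as East steps, so two of these paths share the edge at
    an opening position exactly when they share the edge at the matched
    closing position; common edges come in pairs ([matched_overlap]).
    Different Dyck words give different families ([matched_inj]), and the
    Dyck words are counted by the Catalan number through the ballot recursion
    ([size_dyck]). *)

(** * Overlap of words *)

(** The number of edges shared by the paths that start at abscissae [x] and [y]
    of the same antidiagonal and follow [u] and [w].  On an antidiagonal a
    vertex is determined by its abscissa. *)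
Fixpoint overlap (x y : int) (u w : seq bool) : nat :=
  match u, w with
  | a :: u', b :: w' =>
      ((x == y) && (a == b)) + overlap (x + a)%R (y + b)%R u' w'
  | _, _ => 0
  end.

Lemma overlap_shift d x y u w :
  overlap (x + d)%R (y + d)%R u w = overlap x y u w.
Proof.
elim: u w x y => [|a u IH] [|b w] x y //=.
rewrite (inj_eq (GRing.addIr d)); congr addn.
by rewrite ![(_ + d + _)%R]GRing.addrAC IH.
Qed.

(** * Paths of odd length with pairwise odd intersections *)

Definition meet (F G : int * seq bool) : nat := overlap F.1 G.1 F.2 G.2.

Definition vertex1 (F : int * seq bool) : int := (F.1 + head false F.2)%R.
Definition step1 (F : int * seq bool) : bool := head false F.2.
Definition step2 (F : int * seq bool) : bool := head false (behead F.2).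
Definition straight (F : int * seq bool) : bool := step1 F == step2 F.
Definition drop2 (F : int * seq bool) : int * seq bool :=
  ((vertex1 F + step2 F)%R, drop 2 F.2).

Lemma meet_drop2 F G : 1 < size F.2 -> 1 < size G.2 ->
  meet F G = ((vertex1 F == vertex1 G) && (step1 F == step1 G))
           + ((vertex1 F == vertex1 G) && (step2 F == step2 G))
           + meet (drop2 F) (drop2 G).
Proof.
case: F G => [x [|a [|b u]]] [y [|c [|d w]]] //= _ _.
rewrite /meet /vertex1 /step1 /step2 /= !drop0 -addnA; congr addn.
case: (eqVneq a c) => [->|_]; last by rewrite !andbF.
by rewrite !andbT (inj_eq (GRing.addIr _)).
Qed.

Lemma meet_drop2_apart F G : 1 < size F.2 -> 1 < size G.2 ->
  vertex1 F != vertex1 G -> meet F G = meet (drop2 F) (drop2 G).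
Proof. by move=> sF sG /negbTE ne; rewrite meet_drop2 // ne. Qed.

(** The two deleted edges are shared or not according to the first and to the
    second letter; the two tests have the same outcome exactly when the paths
    are of the same kind. *)
Lemma odd_meet_drop2 F G : 1 < size F.2 -> 1 < size G.2 ->
  vertex1 F = vertex1 G ->
  odd (meet F G) =
  (straight F != straight G) (+) odd (meet (drop2 F) (drop2 G)).
Proof.
move=> sF sG e; rewrite meet_drop2 // e eqxx /= !oddD !oddb /straight.
by congr addb; case: (step1 F) (step2 F) (step1 G) (step2 G) => [] [] [] [].
Qed.

(** Members of [A] of both kinds leave the vertex [v]. *)
Definition mixed (A : seq (int * seq bool)) (v : int) : bool :=
  has (fun F => (vertex1 F == v) && straight F) A
  && has (fun F => (vertex1 F == v) && ~~ straight F) A.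

(** At a mixed vertex the group must follow the kind, to preserve parities;
    elsewhere it follows the second step, to keep [drop2] injective. *)
Definition group_of A F : bool :=
  if mixed A (vertex1 F) then straight F else step2 F.

Lemma mixed_opposite A F : mixed A (vertex1 F) ->
  exists H, [/\ H \in A, vertex1 H = vertex1 F & straight H != straight F].
Proof.
case/andP=> /hasP [H HA /andP [/eqP eH sH]] /hasP [K KA /andP [/eqP eK sK]].
case sF: (straight F); [exists K|exists H]; split=> //.
  by case: straight sK.
by case: straight sH.
Qed.

Definition pairwise_odd (A : seq (int * seq bool)) : Prop :=
  {in A &, forall F G, F != G -> odd (meet F G)}.

(** At a vertex that is not mixed the two paths are of the same kind anyway. *)
Lemma group_straight A F G : F \in A -> G \in A ->
  vertex1 F = vertex1 G -> group_of A F = group_of A G ->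
  straight F = straight G.
Proof.
move=> FA GA e; rewrite /group_of e; case: ifPn => // nmix _.
apply: contraNeq nmix => ne; rewrite /mixed.
by apply/andP; split; apply/hasP; case sF: (straight F) ne;
   case sG: (straight G) => //= _; [exists F|exists G|exists G|exists F];
   rewrite ?e ?eqxx ?sF ?sG.
Qed.

Lemma drop2_odd A F G : pairwise_odd A ->
  {in A, forall F, 1 < size F.2} -> F \in A -> G \in A -> F != G ->
  group_of A F = group_of A G -> odd (meet (drop2 F) (drop2 G)).
Proof.
move=> oddA sA FA GA ne gFG; have := oddA F G FA GA ne.
have [e|ne'] := eqVneq (vertex1 F) (vertex1 G).
  rewrite odd_meet_drop2 ?sA // (@group_straight A F G) // eqxx //.
by rewrite meet_drop2_apart ?sA.
Qed.

(** A path [H] through the vertex of [F] and of the kind opposite to [F] would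
    share an odd number of edges with [F], hence an even number with the common
    remainder of [F] and [G].  But [H] and [G] share no edge before this
    remainder, and they share an odd number of edges. *)
Lemma collision_not_mixed A F G : pairwise_odd A ->
  {in A, forall F, 1 < size F.2} -> F \in A -> G \in A ->
  drop2 F = drop2 G -> vertex1 F != vertex1 G -> ~~ mixed A (vertex1 F).
Proof.
move=> oddA sA FA GA e ne; apply/negP => /mixed_opposite [H [HA eH sH]].
have HF : H != F by apply: contraNneq sH => ->.
have HG : vertex1 H != vertex1 G by rewrite eH.
have /(oddA H G HA GA) : H != G by apply: contraNneq HG => ->.
rewrite meet_drop2_apart ?sA // -e => oHG.
by have := oddA H F HA FA HF; rewrite odd_meet_drop2 ?sA // sH oHG.
Qed.

(** Two paths of a group with the same remainder that pass through different
    vertices have different second steps, and neither vertex is mixed, so the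
    second step would have put them into different groups. *)
Lemma drop2_inj A F G : pairwise_odd A ->
  {in A, forall F, 1 < size F.2} -> F \in A -> G \in A ->
  group_of A F = group_of A G -> drop2 F = drop2 G -> F = G.
Proof.
move=> oddA sA FA GA gFG e.
have [ev|nev] := eqVneq (vertex1 F) (vertex1 G).
  have sFG := @group_straight A F G FA GA ev gFG.
  move: (sA F FA) (sA G GA) e ev sFG.
  case: F G {FA GA gFG} => [x [|a [|b u]]] [y [|c [|d w]]] //= _ _.
  rewrite /drop2 /vertex1 /straight /step1 /step2 /= !drop0 => -[] e -> ev.
  have -> : b = d by move: e; rewrite ev; case: b d => [] []; lia.
  move=> s; have ac : a = c by case: a c d s {e ev} => [] [] [].
  by move: ev; rewrite ac => ev; have -> : x = y by lia.
have nF := @collision_not_mixed A F G oddA sA FA GA e nev.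
have nG : ~~ mixed A (vertex1 G).
  by apply: (@collision_not_mixed A G F) => //; rewrite eq_sym.
move: gFG; rewrite /group_of (negbTE nF) (negbTE nG) => s2.
by case: e nev => e _; case/eqP; move: e; rewrite s2; lia.
Qed.

(** For [k = 0], two different edges share no edge, and zero is even. *)
Lemma pairwise_odd_bound k (A : seq (int * seq bool)) :
  uniq A -> {in A, forall F, size F.2 = k.*2.+1} -> pairwise_odd A ->
  size A <= 2 ^ k.
Proof.
elim: k A => [|k IH] A uA sA oddA.
  case: A uA sA oddA => [|F [|G A]] //= /andP [nF _] sA oddA.
  move: nF; rewrite inE negb_or => /andP [FG _].
  have FA : F \in [:: F, G & A] by rewrite inE eqxx.
  have GA : G \in [:: F, G & A] by rewrite !inE eqxx orbT.
  have oFG := oddA F G FA GA FG.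
  move: oFG FG (sA F FA) (sA G GA).
  case: F G {FA GA sA oddA} => [x [|a [|? ?]]] [y [|b [|? ?]]] //=.
  by rewrite /meet /= addn0 oddb => /andP [/eqP -> /eqP ->]; rewrite eqxx.
have sA2 : {in A, forall F, 1 < size F.2} by move=> F /sA ->.
have half g : size (filter (fun F => group_of A F == g) A) <= 2 ^ k.
  set B := filter _ _; rewrite -(size_map drop2).
  have BA F : F \in B -> F \in A /\ group_of A F = g.
    by rewrite mem_filter => /andP [/eqP].
  apply: IH.
  - rewrite map_inj_in_uniq ?filter_uniq //.
    move=> F G /BA [FA gF] /BA [GA gG]; apply: (@drop2_inj A) => //.
    by rewrite gF gG.
  - by move=> _ /mapP [F /BA [FA _] ->]; rewrite /= size_drop sA.
  move=> _ _ /mapP [F /BA [FA gF] ->] /mapP [G /BA [GA gG] ->] ne.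
  apply: (@drop2_odd A) => //; last by rewrite gF gG.
  by apply: contraNneq ne => ->.
rewrite expnS mul2n -addnn -(count_predC (fun F => group_of A F == true)).
apply: leq_add; first by rewrite -size_filter.
rewrite -size_filter; apply: leq_trans (half false).
by rewrite !size_filter; apply: sub_count => F /=; case: group_of.
Qed.

(** * Dyck words and ballot numbers *)

(** The words of length [m], with [true] for an opening and [false] for a closing
    bracket, that close [h] pending brackets and all those they open. *)
Fixpoint dyck (m h : nat) : seq (seq bool) :=
  match m with
  | 0 => if h == 0 then [:: [::]] else [::]
  | m'.+1 =>
      map (cons true) (dyck m' h.+1)
      ++ (if h is h'.+1 then map (cons false) (dyck m' h') else [::])
  end.

Lemma dyck_uniq m h : uniq (dyck m h).
Proof.
elim: m h => [|m IH] h /=; first by case: ifP.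
have inj b : injective (@cons bool b) by move=> ? ? [].
rewrite cat_uniq map_inj_uniq // IH; case: h => //= h.
rewrite map_inj_uniq // IH andbT.
by apply/hasPn => _ /mapP [u _ ->]; apply/mapP => -[v _].
Qed.

(** The reflection principle, with the negative term moved to the left: [j] is
    the number of closing brackets.  In terms of [m], [h] and [j] the recursion
    is Pascal's rule for both binomials, also where the number [j - h] of opening
    brackets would be negative.  For [h = 0] the missing term is supplied by the
    symmetry of the binomials one row up, where the length is odd. *)
Lemma size_dyck m h j : m + h = j.*2 ->
  size (dyck m h) + 'C(m, j.+1) = 'C(m, j).
Proof.
elim: m h j => [|m IH] h j; first by case: h j => [|h] [|j] //= /eqP.
case: h => [|h] /= e; rewrite size_cat !size_map.
  case: j e => [|j] e; first by lia.
  (* Here m = 2j + 1. *)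
  have e1 := IH 1 j.+1 ltac:(lia).
  have : 'C(m, m - j) = 'C(m, j) by apply: bin_sub; lia.
  have -> : m - j = j.+1 by lia.
  by rewrite !binS /= addn0; lia.
case: j e => [|j] e; first by lia.
have e1 := IH h.+2 j.+1 ltac:(lia); have e2 := IH h j ltac:(lia).
by rewrite !binS; lia.
Qed.

Lemma size_dyck_catalan n : size (dyck n.*2 0) = catalan n.
Proof.
have e := size_dyck n.*2 0 n (addn0 _).
have f := mul_bin_left n.*2 n; have d : n.*2 - n = n by lia.
rewrite d in f; have {}f : 'C(n.*2, n) = size (dyck n.*2 0) * n.+1 by nia.
by rewrite /catalan mul2n f mulnK.
Qed.

(** * Words compatible with a noncrossing matching *)

(** The words with opposite letters at matched positions of [D].  The stack [st]
    holds the letters read at the brackets still open: an opening bracket takes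
    any letter and pushes it, a closing bracket forces the opposite of the top. *)
Fixpoint matched (D st : seq bool) : seq (seq bool) :=
  match D, st with
  | [::], [::] => [:: [::]]
  | true :: D', _ =>
      map (cons true) (matched D' (true :: st))
      ++ map (cons false) (matched D' (false :: st))
  | false :: D', a :: st' => map (cons (~~ a)) (matched D' st')
  | _, _ => [::]
  end.

Lemma matched_open D st a w :
  (a :: w \in matched (true :: D) st) = (w \in matched D (a :: st)).
Proof.
have inj b : injective (@cons bool b) by move=> ? ? [].
rewrite /= mem_cat; case: a; rewrite mem_map //.
  by rewrite orbC; case: mapP => // -[].
by case: mapP => // -[].
Qed.

Lemma matched_close D st a b w :
  (a :: w \in matched (false :: D) (b :: st)) =
  (a == ~~ b) && (w \in matched D st).
Proof.
have inj c : injective (@cons bool c) by move=> ? ? [].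
rewrite /=; case: eqP => [->|ne]; first by rewrite mem_map.
by apply/mapP => -[v _ []].
Qed.

Lemma matched_nil_word D st : [::] \in matched D st -> D = [::] /\ st = [::].
Proof.
case: D st => [|[] D] [|a st] //=; rewrite ?mem_cat; try case/orP;
  by case/mapP.
Qed.

Lemma matched_nil st w : w \in matched [::] st -> st = [::] /\ w = [::].
Proof. by case: st => //=; rewrite inE => /eqP. Qed.

Lemma matched_uniq D st : uniq (matched D st).
Proof.
have inj b : injective (@cons bool b) by move=> ? ? [].
elim: D st => [|[] D IH] [|a st] //=; rewrite ?cat_uniq ?map_inj_uniq ?IH //=;
  by rewrite andbT; apply/hasPn => _ /mapP [u _ ->]; apply/mapP => -[v _].
Qed.

Lemma size_matched m D st : D \in dyck m (size st) ->
  size (matched D st) = 2 ^ (count id D).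
Proof.
elim: m D st => [|m IH] D st /=.
  by case: st => [|? ?] //=; rewrite inE => /eqP ->.
rewrite mem_cat => /orP [/mapP [D' D'm ->]|] /=.
  by rewrite size_cat !size_map !IH // expnD expn1 mul2n addnn.
by case: st => //= a st /mapP [D' D'm ->] /=; rewrite size_map IH.
Qed.

Lemma count_dyck m h D : D \in dyck m h -> m + h = (count id D + h).*2.
Proof.
elim: m h D => [|m IH] h D /=.
  by case: ifP => // /eqP ->; rewrite inE => /eqP ->.
rewrite mem_cat => /orP [/mapP [D' /IH e ->] /=|]; first by lia.
by case: h => // h /mapP [D' /IH e ->] /=; lia.
Qed.

Lemma count_matched b D st w : w \in matched D st ->
  count (pred1 b) w = count id D + count (predC1 b) st.
Proof.
elim: D st w => [|[] D IH] st w.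
- by case/matched_nil => -> ->.
- case: w => [/matched_nil_word [] //|a w].
  rewrite matched_open => /IH /= -> {IH}.
  by case: a b => [] [] /=; lia.
case: st => // a st; case: w => [/matched_nil_word [] //|c w].
rewrite matched_close => /andP [/eqP -> /IH /= -> {IH}].
by case: a b => [] [] /=; lia.
Qed.

(** Up to parity only the pending brackets count: the common edges at positions
    opened and closed within [D] come in pairs, and what remains is the
    contribution of the forced letters, as if they were read in a row.  With
    empty stacks the overlap is therefore even. *)
Lemma matched_overlap D st st' u w x y : size st = size st' ->
  u \in matched D st -> w \in matched D st' ->
  odd (overlap x y u w) = odd (overlap x y (map negb st) (map negb st')).
Proof.
elim: D st st' u w x y => [|[] D IH] st st' u w x y est.
- by case/matched_nil => -> ->; case/matched_nil => -> ->.
- case: u => [/matched_nil_word [] //|a u]; rewrite matched_open => uD.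
  case: w => [/matched_nil_word [] //|b w]; rewrite matched_open => wD.
  rewrite /= oddD (IH (a :: st) (b :: st') u w) //=; last by rewrite est.
  (* The letter just read and its forced opposite advance both paths by one
     unit, and the two paths share either both of these edges or neither. *)
  have shift (z : int) (c : bool) : (z + c + ~~ c = z + 1)%R by case: c; lia.
  rewrite !shift overlap_shift oddD !oddb addbA (inj_eq (can_inj negbK)).
  have [->|_] := eqVneq a b; last by rewrite !andbF.
  by rewrite (inj_eq (GRing.addIr _)) addbb.
case: st est => // a st; case: st' => // b st' [est].
case: u => [/matched_nil_word [] //|c u]; rewrite matched_close.
case/andP=> /eqP -> uD; case: w => [/matched_nil_word [] //|d w].
rewrite matched_close => /andP [/eqP -> wD] /=.
by rewrite !oddD (IH st st' u w).
Qed.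

(** At the first difference between two Dyck words one of them opens a bracket,
    and both letters are possible there, while the other one closes a bracket,
    and the letter is forced. *)
Lemma matched_inj m D D' st :
  D \in dyck m (size st) -> D' \in dyck m (size st) ->
  matched D st =i matched D' st -> D = D'.
Proof.
have ex k st1 D1 : D1 \in dyck k (size st1) -> exists w, w \in matched D1 st1.
  move/size_matched; case: matched => [/eqP|w s _]; last first.
    by exists w; rewrite inE eqxx.
  by rewrite eq_sym expn_eq0.
have open_close k D1 D2 a st1 : D1 \in dyck k (size st1).+2 ->
    ~ matched (true :: D1) (a :: st1) =i matched (false :: D2) (a :: st1).
  move=> D1k e; have [w wD1] := ex k (a :: a :: st1) D1 D1k.
  by have := e (a :: w); rewrite matched_open wD1 matched_close; case: (a).
elim: m D D' st => [|m IH] D D' st /=.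
  by case: ifP => // _; rewrite !inE => /eqP -> /eqP ->.
rewrite !mem_cat => /orP [/mapP [E Em ->]|+] /orP [/mapP [E' Em' ->]|+].
- move=> e; congr cons; apply: (IH _ _ (true :: st)) => // w.
  by rewrite -!matched_open.
- by case: st Em => //= a st Em /mapP [E' _ ->] /(open_close m).
- by case: st Em' => //= a st Em /mapP [E2 _ ->] /fsym /(open_close m).
case: st => // a st /mapP [E Em ->] /mapP [E' Em' ->] e.
congr cons; apply: (IH _ _ st) => // w.
by have := e (~~ a :: w); rewrite !matched_close eqxx.
Qed.

(** * Lattice paths as words *)

Local Open Scope fset_scope.

Definition advance (p : vertex) (a : bool) : vertex :=
  (p.1 + a, p.2 + ~~ a)%R.

(** The path from [p] that follows [w]; [turns] reads the word back. *)
Fixpoint trace (p : vertex) (w : seq bool) : seq vertex :=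
  p :: (if w is a :: w' then trace (advance p a) w' else [::]).

Fixpoint turns (p : vertex) (s : seq vertex) : seq bool :=
  if s is q :: s' then (q.1 != p.1) :: turns q s' else [::].

Lemma trace_cons p w : trace p w = p :: behead (trace p w).
Proof. by case: w. Qed.

Lemma NE_stepP p q : reflect (exists a, q = advance p a) (NE_step p q).
Proof.
case: p q => [x y] [z t]; rewrite /NE_step /=; apply: (iffP orP).
  by case=> /eqP [e f]; [exists false|exists true]; rewrite /advance /=;
    congr pair; lia.
by case=> -[] [-> ->]; [right|left]; apply/eqP; congr pair; lia.
Qed.

Lemma turns_trace p w : turns p (behead (trace p w)) = w.
Proof.
elim: w p => //= a w IH p; rewrite trace_cons /= IH; congr cons.
by case: a; lia.
Qed.

Lemma trace_turns p s : path NE_step p s -> trace p (turns p s) = p :: s.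
Proof.
elim: s p => //= q s IH p /andP [/NE_stepP [a e] /IH <-].
congr (_ :: trace _ _); rewrite e /advance /=; congr pair; case: a e; lia.
Qed.

Lemma trace_path p w : path NE_step p (behead (trace p w)).
Proof.
elim: w p => //= a w IH p; rewrite trace_cons /= IH andbT.
by apply/NE_stepP; exists a.
Qed.

Lemma last_trace p w q : last q (trace p w) =
  (p.1 + (count (pred1 true) w)%:Z, p.2 + (count (pred1 false) w)%:Z)%R.
Proof.
elim: w p q => [|a w IH] p q /=; first by case: p => x y; congr pair => /=; lia.
by rewrite IH /=; congr pair; case: a => /=; lia.
Qed.

Lemma lattice_path_trace p q w : lattice_path_from_to p q (trace p w) =
  (q == (p.1 + (count (pred1 true) w)%:Z,
         p.2 + (count (pred1 false) w)%:Z)%R).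
Proof.
rewrite /lattice_path_from_to /lattice_path last_trace trace_cons /= eqxx.
by rewrite trace_path /= eq_sym.
Qed.

Lemma lattice_pathP p q F : lattice_path_from_to p q F ->
  F = trace p (turns p (behead F)).
Proof.
case: F => [|x s] //; rewrite /lattice_path_from_to /lattice_path /=.
by case/and3P=> sF /eqP <- _; rewrite trace_turns.
Qed.

Lemma edge_set_trace_cons p a w : edge_set (trace p (a :: w)) =
  [fset p; advance p a] |` edge_set (trace (advance p a) w).
Proof.
rewrite /edge_set /= [in LHS]trace_cons /= -trace_cons.
apply/fsetP => e; apply/imfsetP/fset1UP => /= [[d]|[->|]].
- rewrite inE => /orP [/eqP -> -> /=|dF ->]; [by left|right].
  by apply/imfsetP; exists d.
- by exists (p, advance p a); rewrite ?inE ?eqxx.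
by case/imfsetP=> d /= dF ->; exists d; rewrite // inE dF orbT.
Qed.

(** The index of an antidiagonal.  Every step raises it by one, so the first edge
    of a path does not occur later, on this path or on any other path that
    starts on the same antidiagonal. *)
Definition level (p : vertex) : int := (p.1 + p.2)%R.

Lemma level_advance p a : level (advance p a) = (level p + 1)%R.
Proof. by rewrite /level /=; case: a; lia. Qed.

Lemma edge_level p w e v : e \in edge_set (trace p w) -> v \in e ->
  (level p <= level v)%R.
Proof.
elim: w p => [|a w IH] p; first by case/imfsetP.
rewrite edge_set_trace_cons => /fset1UP [->|/IH h /h].
  by rewrite !inE => /orP [] /eqP ->; rewrite ?level_advance; lia.
by rewrite level_advance; lia.
Qed.

Lemma card_common_edges p q u w : level p = level q ->
  #|` common_edges (trace p u) (trace q w)| = overlap p.1 q.1 u w.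
Proof.
elim: u w p q => [|a u IH] [|b w] p q epq.
- by apply/eqP; rewrite cardfs_eq0; apply/eqP/fsetP => e; rewrite !inE;
    apply/andP => -[/imfsetP []].
- by apply/eqP; rewrite cardfs_eq0; apply/eqP/fsetP => e; rewrite !inE;
    apply/andP => -[/imfsetP []].
- by apply/eqP; rewrite cardfs_eq0; apply/eqP/fsetP => e; rewrite !inE;
    apply/andP => -[_ /imfsetP []].
have above r s c d v : level r = level s ->
    [fset r; advance r c] \notin edge_set (trace (advance s d) v).
  move=> ers; apply/negP => rF.
  have /(edge_level _ _ _ r rF) : r \in [fset r; advance r c].
    by rewrite !inE eqxx.
  by rewrite level_advance ers; lia.
have e' : level (advance p a) = level (advance q b).
  by rewrite !level_advance epq.
rewrite /= -(IH w (advance p a) (advance q b) e') /common_edges.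
rewrite !edge_set_trace_cons.
set X := edge_set (trace (advance p a) u).
set Y := edge_set (trace (advance q b) w).
have -> : (p.1 == q.1) && (a == b) =
    ([fset p; advance p a] == [fset q; advance q b]).
  apply/andP/eqP => [[/eqP e1 /eqP ->]|e].
    have -> // : p = q.
    by case: p q epq e1 {IH e' X Y} => x y [z t]; rewrite /level /= => f e1;
      congr pair; lia.
  have ep : p = q.
    have : p \in [fset q; advance q b] by rewrite -e !inE eqxx.
    rewrite !inE => /orP [/eqP //|/eqP f].
    by have := level_advance q b; rewrite -f epq; lia.
  have : advance p a \in [fset q; advance q b] by rewrite -e !inE eqxx orbT.
  rewrite !inE ep => /orP [/eqP f|/eqP [f _]].
    by have := level_advance q a; rewrite f; lia.
  by split; [|move: f; case: a b {e e' X Y} => [] []; lia].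
have [->|ne] := eqVneq [fset p; advance p a] [fset q; advance q b].
  rewrite -fsetUIr cardfsU1 inE (negbTE (above q q b b w erefl)).
  by rewrite andbF.
congr (#|` _|); apply/fsetP => e; rewrite !inE.
have [->|_] := eqVneq e [fset p; advance p a].
  by rewrite (negbTE ne) (negbTE (above p q a b w epq)) andbF.
have [->|//] := eqVneq e [fset q; advance q b].
by rewrite (negbTE (above q p b a u (esym epq))).
Qed.

(** * The families of the Dyck words, and their extremality *)

Definition origin : vertex := (0%:Z, 0%:Z)%R.

Definition family (D : seq bool) : {fset seq vertex} :=
  [fset trace origin w | w in matched D [::]].

Lemma trace_inj p : injective (trace p).
Proof. by move=> u w /(congr1 (turns p \o behead)) /=; rewrite !turns_trace. Qed.

Lemma card_fset_image (T U : choiceType) (f : T -> U) (s : seq T) :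
  uniq s -> {in s &, injective f} -> #|` [fset f x | x in s]| = size s.
Proof.
move=> us inj; rewrite card_in_imfset //=.
by rewrite undup_id.
Qed.

Lemma family_even n D : D \in dyck n.*2 0 -> even_path_family n (family D).
Proof.
move=> Dn; have cD : count id D = n.
  by have := count_dyck _ _ _ Dn; rewrite !addn0 => /double_inj.
split=> [_ /imfsetP [w /= wD ->]|].
  rewrite lattice_path_trace !(count_matched _ _ _ _ wD) /= !addn0 cD.
  by apply/eqP; congr pair; lia.
move=> _ _ /imfsetP [u /= uD ->] /imfsetP [w /= wD ->] _.
by rewrite card_common_edges // (matched_overlap D [::] [::]).
Qed.

Lemma card_family n D : D \in dyck n.*2 0 -> #|` family D| = 2 ^ n.
Proof.
move=> Dn; rewrite card_fset_image ?matched_uniq //; last first.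
  by move=> ? ? _ _ /trace_inj.
rewrite (size_matched n.*2 D [::] Dn).
by have := count_dyck _ _ _ Dn; rewrite !addn0 => /double_inj <-.
Qed.

Lemma family_inj m : {in dyck m 0 &, injective family}.
Proof.
move=> D D' Dm Dm' e; apply: (matched_inj m D D' [::]) => // w.
have mem E : (w \in matched E [::]) = (trace origin w \in family E).
  by apply/idP/imfsetP => [wE|[v /= vE /trace_inj ->]] //; exists w.
by rewrite !mem e.
Qed.

(** A common first edge, here a North step, turns even intersections into odd
    ones and the length [2n] into [2n + 1]. *)
Lemma even_family_bound n (B : {fset seq vertex}) :
  even_path_family n B -> #|` B| <= 2 ^ n.
Proof.
case=> pathB evenB.
pose code F := (0%R : int, false :: turns origin (behead F)).
have codeK F : F \in B -> trace origin (turns origin (behead F)) = F.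
  by move/pathB/lattice_pathP.
rewrite -(size_map code); apply: pairwise_odd_bound.
- rewrite map_inj_in_uniq ?fset_uniq // => F G FB GB [e].
  by rewrite -(codeK F FB) e codeK.
- move=> _ /mapP [F FB ->] /=; congr _.+1.
  have := pathB F FB; rewrite -{1}(codeK F FB) lattice_path_trace.
  set w := turns _ _ => /eqP [e1 e2].
  have := count_predC (pred1 true) w.
  rewrite (@eq_count _ (predC _) (pred1 false)); last by case.
  by move: e1 e2; rewrite /= !add0n => -[<-] [<-]; rewrite addnn => <-.
move=> _ _ /mapP [F FB ->] /mapP [G GB ->] ne.
have FG : F != G by apply: contraNneq ne => ->.
have := evenB F G FB GB FG; rewrite -{1}(codeK F FB) -{1}(codeK G GB).
by rewrite card_common_edges // /meet /= => ->.
Qed.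

Theorem mainTheorem3 (n : nat) (hn : 0 < n) :
  exists Fams : {fset {fset seq vertex}},
    catalan n <= #|` Fams| /\
    forall A : {fset seq vertex}, A \in Fams ->
      [/\ even_path_family n A, #|` A| = 2 ^ n & extremal n A].
Proof.
exists [fset family D | D in dyck n.*2 0]; split.
  rewrite card_fset_image ?dyck_uniq ?size_dyck_catalan //.
  exact: family_inj.
move=> _ /imfsetP [D /= Dn ->].
have evenD := family_even n D Dn; have cardD := card_family n D Dn.
by split=> //; split=> // B evenB; rewrite cardD even_family_bound.
Qed.
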